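(* Let $G\subset S_N^+$ be a closed subgroup which is quasi-transitive, with orbits having size $K$. Let $X$ be a connected compact probability space. Then any stationary matrix model $\pi:C(G)\to M_K(C(X))$ is automatically quasi-flat.
   Context: A magic unitary is a square matrix over a $C^*$-algebra whose entries are projections, summing up to $1$ on each row and each column. $C(S_N^+)$ is the universal $C^*$-algebra generated by the entries of an $N\times N$ magic unitary $u=(u_{ij})$, with comultiplication $\Delta(u_{ij})=\sum_ku_{ik}\otimes u_{kj}$, counit $\varepsilon(u_{ij})=\delta_{ij}$ and antipode $S(u_{ij})=u_{ji}$; $S_N^+$ is the corresponding compact quantum group (quantum permutation group). A closed subgroup $G\subset S_N^+$ corresponds to a quotient $C(S_N^+)\to C(G)$ compatible with $\Delta,\varepsilon,S$; the images of the standard generators are still denoted $u_{ij}\in C(G)$. $\int_G$ is the Haar integration (Haar state) of $C(G)$. The orbits of $G\subset S_N^+$ are the equivalence classes of the equivalence relation on $\{1,\ldots,N\}$ given by $i\sim j$ when $u_{ij}\neq0$ in $C(G)$. $G$ is quasi-transitive when all orbits have the same size. A matrix model is a morphism of $C^*$-algebras $\pi:C(G)\to M_K(C(X))$, with $X$ a compact space; write $\pi(u_{ij})=(x\mapsto P_{ij}^x)$, with $P_{ij}^x\in M_K(\mathbb C)$ projections. When $X$ is a compact probability space, it is stationary when $\int_G=(tr\otimes\int_X)\pi$, via $M_K(C(X))\simeq M_K(\mathbb C)\otimes C(X)$, with $tr$ the normalized trace of $M_K(\mathbb C)$. For $G$ quasi-transitive with orbits of size $K$, a model $\pi:C(G)\to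 M_K(C(X))$ is quasi-flat when $u_{ij}\neq0$ implies $rank(P_{ij}^x)=1$ for any $x\in X$. *)

(* Defs.v *)
From HB Require Import structures.
From mathcomp Require Import all_boot all_order all_algebra.
From mathcomp Require Import complex.
From mathcomp Require Import all_classical all_reals all_analysis.

Set Implicit Arguments.
Unset Strict Implicit.
Unset Printing Implicit Defensive.

Import Order.TTheory GRing.Theory Num.Theory.
Import numFieldNormedType.Exports.

Local Open Scope classical_set_scope.
Local Open Scope ring_scope.

(* Unital (nonzero) C*-algebras over C = R[i].  The norm is a field of the
   structure because Hierarchy Builder rejects a structure joining rings with
   normed modules that is not placed below numDomainType.  The involution is
   called cstar. *)
HB.mixin Record Algebra_isCStar (R : realType) A & GRing.Algebra R[i] A := {
  cstar : A -> A;
  cnorm : A -> R;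
  cstarK : involutive cstar;
  cstarD : forall x y : A, cstar (x + y) = cstar x + cstar y;
  cstarZ : forall (l : R[i]) (x : A), cstar (l *: x) = l^* *: cstar x;
  cstarM : forall x y : A, cstar (x * y) = cstar y * cstar x;
  cnorm_eq0 : forall x : A, cnorm x = 0 -> x = 0;
  cnormD : forall x y : A, cnorm (x + y) <= cnorm x + cnorm y;
  cnormZ : forall (l : R[i]) (x : A), cnorm (l *: x) = Normc.normc l * cnorm x;
  cnormM : forall x y : A, cnorm (x * y) <= cnorm x * cnorm y;
  cnorm_star : forall x : A, cnorm (cstar x * x) = cnorm x ^+ 2;
  cnorm_complete : forall v : nat -> A,
    (forall e : R, 0 < e -> exists n0 : nat, forall m n : nat,
        (n0 <= m)%N -> (n0 <= n)%N -> cnorm (v m - v n) < e) ->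
    exists l : A, (fun n => cnorm (v n - l)) @ \oo --> (0 : R)
}.

#[short(type="cstarAlgType")]
HB.structure Definition CStarAlgebra (R : realType) :=
  {A of GRing.Algebra R[i] A & Algebra_isCStar R A}.

Definition cclosure (R : realType) (A : cstarAlgType R) (D : set A) : set A :=
  [set x | forall e : R, 0 < e -> exists2 y, D y & cnorm (x - y) < e].

Definition bounded_linear (R : realType) (A B : cstarAlgType R) (L : A -> B) :
    Prop :=
  (forall (l : R[i]) x y, L (l *: x + y) = l *: L x + L y) /\
  exists c : R, forall x, cnorm (L x) <= c * cnorm x.

(* Morphisms of C*-algebras are the unital *-homomorphisms, which are
   automatically contractive.  The target is given by its ring structure, its
   scaling by R[i] and its involution, so that the same notion serves for
   C*-algebras, C, opposite algebras and M_K(C(X)). *)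
Definition star_morphism (R : realType) (A : cstarAlgType R) (B : pzRingType)
    (scaleB : R[i] -> B -> B) (starB : B -> B) (f : A -> B) : Prop :=
  [/\ forall x y, f (x + y) = f x + f y,
      forall x y, f (x * y) = f x * f y,
      f 1 = 1,
      forall (l : R[i]) x, f (l *: x) = scaleB l (f x)
    & forall x, f (cstar x) = starB (f x)].

Definition cstar_morphism (R : realType) (A B : cstarAlgType R) (f : A -> B) :=
  star_morphism (fun l (y : B) => l *: y) (fun y : B => cstar y) f.

Definition cstar_character (R : realType) (A : cstarAlgType R)
    (f : A -> R[i]) :=
  star_morphism (fun l y : R[i] => l * y) (fun y : R[i] => y^*) f.

(* Morphisms A -> A^op; A^c is the opposite ring of A. *)
Definition cstar_opmorphism (R : realType) (A : cstarAlgType R)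
    (f : A -> A) :=
  star_morphism (B := A^c) (fun l (y : A) => l *: y)
    (fun y : A => cstar y) f.

(* T, with the elementary tensors t a b, is a C*-completion of the algebraic
   tensor product of A and B: the *-algebra map from the algebraic tensor
   product to T is well defined, injective, and has dense image. *)
Record cstar_tensor (R : realType) (A B T : cstarAlgType R)
    (t : A -> B -> T) : Prop := {
  ctensDl : forall a a' b, t (a + a') b = t a b + t a' b;
  ctensDr : forall a b b', t a (b + b') = t a b + t a b';
  ctensZl : forall (l : R[i]) a b, t (l *: a) b = l *: t a b;
  ctensZr : forall (l : R[i]) a b, t a (l *: b) = l *: t a b;
  ctens11 : t 1 1 = 1;
  ctensM : forall a a' b b', t (a * a') (b * b') = t a b * t a' b';
  ctens_star : forall a b, t (cstar a) (cstar b) = cstar (t a b);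
  ctens_inj : forall n (a : 'I_n -> A) (b : 'I_n -> B),
    (forall c : 'I_n -> R[i],
        \sum_i c i *: b i = 0 -> forall i, c i = 0) ->
    \sum_i t (a i) (b i) = 0 -> forall i, a i = 0;
  ctens_dense : cclosure [set x : T |
    exists n (a : 'I_n -> A) (b : 'I_n -> B), x = \sum_i t (a i) (b i)] = setT
}.

Definition projection (R : realType) (A : cstarAlgType R) (p : A) : Prop :=
  cstar p = p /\ p * p = p.

Definition magic_unitary (R : realType) (A : cstarAlgType R) (N : nat)
    (u : 'M[A]_N) : Prop :=
  [/\ forall i j, projection (u i j),
      forall i, \sum_j u i j = 1
    & forall j, \sum_i u i j = 1].

Definition cstar_subalgebra (R : realType) (A : cstarAlgType R)
    (D : set A) : Prop :=
  [/\ cclosure D `<=` D, D 1,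
      forall (l : R[i]) x y, D x -> D y -> D (l *: x + y),
      forall x y, D x -> D y -> D (x * y)
    & forall x, D x -> D (cstar x)].

Definition cstar_generated (R : realType) (A : cstarAlgType R) (N : nat)
    (u : 'M[A]_N) : Prop :=
  forall D : set A, cstar_subalgebra D -> (forall i j, D (u i j)) -> D = setT.

(* A C*-algebra with a magic unitary and the structure maps of a compact
   quantum group, given on the standard generators by the usual formulae.
   qtens is the codomain A (x) A of the comultiplication, which may be
   any C*-completion of the algebraic tensor product (minimal, maximal, ...). *)
Record qperm_algebra (R : realType) (N : nat) := QPermAlgebra {
  qalg : cstarAlgType R;
  qgen : 'M[qalg]_N;
  qtens : cstarAlgType R;
  qten : qalg -> qalg -> qtens;
  comult : qalg -> qtens;
  counit : qalg -> R[i];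
  antipode : qalg -> qalg;
  qgen_magic : magic_unitary qgen;
  qgen_generated : cstar_generated qgen;
  qtenP : cstar_tensor qten;
  comult_morphism : cstar_morphism comult;
  counit_morphism : cstar_character counit;
  antipode_morphism : cstar_opmorphism antipode;
  comult_gen : forall i j,
    comult (qgen i j) = \sum_k qten (qgen i k) (qgen k j);
  counit_gen : forall i j, counit (qgen i j) = (i == j)%:R;
  antipode_gen : forall i j, antipode (qgen i j) = qgen j i
}.

(* S is C(S_N^+): it is generated by its magic unitary (so the morphism below
   is unique), and it is universal for this property. *)
Definition is_SNplus (R : realType) (N : nat) (S : qperm_algebra R N) : Prop :=
  forall (A : cstarAlgType R) (v : 'M[A]_N), magic_unitary v ->
    exists f : qalg S -> A,
      cstar_morphism f /\ forall i j, f (qgen S i j) = v i j.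

(* G is a quotient of S, compatibly with the generators and the structure
   maps; qq is the tensor square of the quotient map q. *)
Definition closed_subgroup (R : realType) (N : nat) (G S : qperm_algebra R N) :
    Prop :=
  exists (q : qalg S -> qalg G) (qq : qtens S -> qtens G),
    [/\ cstar_morphism q,
        forall y, exists x, q x = y,
        forall i j, q (qgen S i j) = qgen G i j,
        cstar_morphism qq /\
          (forall a b, qq (qten a b) = qten (q a) (q b))
      & [/\ forall x, comult (q x) = qq (comult x),
            forall x, counit (q x) = counit x
          & forall x, antipode (q x) = q (antipode x)]].

(* The relation i ~ j is an equivalence relation thanks to the counit, the
   antipode and the comultiplication. *)
Definition qorbits (R : realType) (N : nat) (G : qperm_algebra R N) :
    {set {set 'I_N}} :=
  equivalence_partition (fun i j => qgen G i j != 0) [set: 'I_N]%SET.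

Definition quasi_transitive (R : realType) (N : nat) (G : qperm_algebra R N)
    (K : nat) : Prop :=
  forall O : {set 'I_N}, O \in qorbits G -> #|O| = K.

Definition cstar_state (R : realType) (A : cstarAlgType R) (h : A -> R[i]) :
    Prop :=
  [/\ forall (l : R[i]) x y, h (l *: x + y) = l * h x + h y,
      h 1 = 1
    & forall x, 0 <= h (cstar x * x)].

(* The Haar state: (h (x) id) Delta = h(.) 1 = (id (x) h) Delta, where the
   slice maps h (x) id and id (x) h are the bounded linear maps determined
   by their values on elementary tensors. *)
Definition is_haar (R : realType) (N : nat) (G : qperm_algebra R N)
    (h : qalg G -> R[i]) : Prop :=
  [/\ cstar_state h,
      exists L : qtens G -> qalg G,
        [/\ bounded_linear L,
            forall a b, L (qten a b) = h a *: b
          & forall a, L (comult a) = h a *: 1]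
    & exists L : qtens G -> qalg G,
        [/\ bounded_linear L,
            forall a b, L (qten a b) = h b *: a
          & forall a, L (comult a) = h a *: 1]].

(* C(X); the topology on C is that of R[i]^o, the normed space R[i]. *)
Definition cfun (R : realType) (X : topologicalType) : Type :=
  continuousType X R[i]^o.

Section CFunRing.
Context (R : realType) (X : topologicalType).
Implicit Types f g : cfun R X.

HB.instance Definition _ := gen_eqMixin (cfun R X).
HB.instance Definition _ := gen_choiceMixin (cfun R X).

Definition cfun_eval (x : X) f : R[i] := (f : continuousType X R[i]^o) x.

Lemma cfun_continuous f : continuous (fun x => cfun_eval x f : R[i]^o).
Proof. exact: (@cts_fun _ _ f). Qed.

Lemma cfunP f g : (forall x, cfun_eval x f = cfun_eval x g) -> f = g.
Proof. by move=> fg; apply/continuousEP => x; exact: fg. Qed.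

Definition mkcfun (f : X -> R[i]) (cf : continuous (f : X -> R[i]^o)) :
  cfun R X := mkcts cf.

Definition cfun_cst (c : R[i]) : cfun R X :=
  mkcfun (f := fun=> c) (fun x => @cvg_cst R[i]^o c X (nbhs x) _).

Definition cfun_add f g : cfun R X :=
  mkcfun (f := fun x => cfun_eval x f + cfun_eval x g)
    (fun x => @cvgD R[i] R[i]^o X (nbhs x) _ _ _ _ _
                (@cfun_continuous f x) (@cfun_continuous g x)).

Definition cfun_opp f : cfun R X :=
  mkcfun (f := fun x => - cfun_eval x f)
    (fun x => @cvgN R[i] R[i]^o X (nbhs x) _ _ _ (@cfun_continuous f x)).

Definition cfun_mul f g : cfun R X :=
  mkcfun (f := fun x => cfun_eval x f * cfun_eval x g)
    (fun x => @cvgM R[i] X (nbhs x) _ _ _ _ _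
                (@cfun_continuous f x) (@cfun_continuous g x)).

Fact cfun_conj_continuous f :
  continuous (fun x => (cfun_eval x f)^* : R[i]^o).
Proof.
move=> x; apply/cvgrPdist_lt => e e0; near=> y.
rewrite -rmorphB norm_conjC; near: y.
by move: e e0; apply/cvgrPdist_lt; exact: (@cfun_continuous f x).
Unshelve. all: by end_near. Qed.

Definition cfun_conj f : cfun R X := mkcfun (@cfun_conj_continuous f).

Fact cfun_addA : associative cfun_add.
Proof. by move=> f g h; apply: cfunP => x; exact: addrA. Qed.
Fact cfun_addC : commutative cfun_add.
Proof. by move=> f g; apply: cfunP => x; exact: addrC. Qed.
Fact cfun_add0 : left_id (cfun_cst 0) cfun_add.
Proof. by move=> f; apply: cfunP => x; exact: add0r. Qed.
Fact cfun_addN : left_inverse (cfun_cst 0) cfun_opp cfun_add.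
Proof. by move=> f; apply: cfunP => x; exact: addNr. Qed.
HB.instance Definition _ :=
  GRing.isZmodule.Build (cfun R X) cfun_addA cfun_addC cfun_add0 cfun_addN.

Fact cfun_mulA : associative cfun_mul.
Proof. by move=> f g h; apply: cfunP => x; exact: mulrA. Qed.
Fact cfun_mulC : commutative cfun_mul.
Proof. by move=> f g; apply: cfunP => x; exact: mulrC. Qed.
Fact cfun_mul1 : left_id (cfun_cst 1) cfun_mul.
Proof. by move=> f; apply: cfunP => x; exact: mul1r. Qed.
Fact cfun_mulDl : left_distributive cfun_mul cfun_add.
Proof. by move=> f g h; apply: cfunP => x; exact: mulrDl. Qed.
HB.instance Definition _ := GRing.Zmodule_isComPzRing.Build (cfun R X)
  cfun_mulA cfun_mulC cfun_mul1 cfun_mulDl.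

End CFunRing.

(* M_K(C(X)) is 'M[cfun R X]_K: R[i] acts through the constant functions, and
   the involution is the conjugate transpose. *)
Definition matrix_model (R : realType) (N : nat) (G : qperm_algebra R N)
    (K : nat) (X : topologicalType) (pi : qalg G -> 'M[cfun R X]_K) : Prop :=
  star_morphism (fun (l : R[i]) (M : 'M[cfun R X]_K) => cfun_cst X l *: M)
    (fun M : 'M[cfun R X]_K => map_mx (@cfun_conj R X) M^T) pi.

(* For a of the form u_ij, the value at x of pi a is the matrix P_ij^x. *)
Definition model_fiber (R : realType) (K : nat) (X : topologicalType)
    (M : 'M[cfun R X]_K) (x : X) : 'M[R[i]]_K :=
  map_mx (cfun_eval x) M.

(* The measure of a compact probability space X is a probability on the
   Borel sigma-algebra, generated by the open sets. *)
Notation borelType X := (g_sigma_algebraType (@open X)).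

Definition cfun_integral (R : realType) (X : ptopologicalType)
    (mu : probability (borelType X) R) (f : cfun R X) : R[i] :=
  Complex (Rintegral mu setT (fun x : borelType X => complex.Re (cfun_eval x f)))
          (Rintegral mu setT (fun x : borelType X => complex.Im (cfun_eval x f))).

(* tr (x) int_X, with tr the normalized trace of M_K(C). *)
Definition model_trace (R : realType) (K : nat) (X : ptopologicalType)
    (mu : probability (borelType X) R) (M : 'M[cfun R X]_K) : R[i] :=
  \tr (map_mx (cfun_integral mu) M) / K%:R.

Definition stationary (R : realType) (N : nat) (G : qperm_algebra R N)
    (h : qalg G -> R[i]) (K : nat) (X : ptopologicalType)
    (mu : probability (borelType X) R) (pi : qalg G -> 'M[cfun R X]_K) : Prop :=
  forall a, h a = model_trace mu (pi a).

Definition quasi_flat (R : realType) (N : nat) (G : qperm_algebra R N)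
    (K : nat) (X : topologicalType) (pi : qalg G -> 'M[cfun R X]_K) : Prop :=
  forall i j, qgen G i j != 0 ->
    forall x : X, \rank (model_fiber (pi (qgen G i j)) x) = 1%N.

(* Main.v *)
Require Import Defs.
From mathcomp Require Import all_boot all_order all_algebra.
From mathcomp Require Import complex.
From mathcomp Require Import all_classical all_reals all_analysis.
From mathcomp Require Import zify lra.

(** Each [pi (u i j)] is an idempotent of M_K(C(X)), so the rank of its value
at [x] is its trace there: an integer depending continuously on [x], hence a
constant [n] when [X] is connected.  Stationarity then reads
[haar (u i j) = n / K], and the theorem amounts to the flatness of the Haar
state on the generators: [haar (u i j) = 1 / K] as soon as [u i j != 0]
(lemma [haar_qgen]).

Flatness follows from invariance and a maximum principle.  Write [r k] for
[haar (u i k)], a nonnegative real.  Slicing the comultiplication gives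
[\sum_k r k *: u k l = r l *: 1] for every [l].  Choose [m] with [r m] maximal.
The column [m] of the magic unitary sums to 1, so
[\sum_k (r m - r k) *: u k m = 0] is a nonnegative combination of projections
that vanishes.  Hence [r k = r m] whenever [u k m != 0]: the maximum is attained
on the whole orbit of [m], that is, at [K] indices at least.  It is positive,
because the [r k] sum to 1, so it is attained only where [u i k != 0], which
leaves the [K] elements of the orbit of [i].  Thus [r] is constant on this orbit
and zero elsewhere, and its total mass 1 forces the value [1 / K].

The only input from C*-algebra theory is that the terms of a vanishing
nonnegative combination of projections vanish ([sum_projections_eq0]), which
comes from a norm estimate instead of the theory of positive elements. *)

Set Implicit Arguments.
Unset Strict Implicit.
Unset Printing Implicit Defensive.

Import Order.TTheory GRing.Theory Num.Theory.
Import numFieldNormedType.Exports.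

Local Open Scope classical_set_scope.
Local Open Scope ring_scope.

(** * Nonnegative combinations of projections *)

Section CStarProjections.
Context (R : realType) (A : cstarAlgType R).
Implicit Types p : A.

Lemma cnorm0 : cnorm (0 : A) = 0.
Proof. by rewrite -(scale0r 0) cnormZ Normc.normc0 mul0r. Qed.

Lemma cnorm_ge0 (x : A) : 0 <= cnorm x.
Proof.
have nN : cnorm (- x) = cnorm x.
  by rewrite -scaleN1r cnormZ -[-1]/(- 1%C) normcN Normc.normc1 mul1r.
by have := cnormD x (- x); rewrite subrr cnorm0 nN; lra.
Qed.

Lemma cnorm_scale_real (c : R) (x : A) :
  0 <= c -> cnorm ((c%:C)%C *: x) = c * cnorm x.
Proof.
by move=> c0; rewrite cnormZ /= expr0n /= addr0 sqrtr_sqr ger0_norm.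
Qed.

Lemma cnorm_projection p : projection p -> cnorm p <= 1.
Proof.
move=> [sp pp]; have := cnorm_star p; rewrite sp pp => ee.
by have := cnorm_ge0 p; nra.
Qed.

Lemma cstar1 : cstar (1 : A) = 1.
Proof.
have : cstar (cstar (1 : A) * 1) = 1 by rewrite mulr1 cstarK.
by rewrite cstarM cstarK mulr1.
Qed.

Lemma projection_compl p : projection p -> projection (1 - p).
Proof.
move=> [sp pp]; split.
- by rewrite cstarD cstar1 -scaleN1r cstarZ sp rmorphN1 scaleN1r.
- by rewrite mulrBr mulr1 mulrBl mul1r pp subrr subr0.
Qed.

(** Put [s] for the sum of the weights other than [c i], and [y] for the same
combination of the complements [1 - p k].  Then [y] has norm at most [s],
whereas the hypothesis makes [p i * y] equal to [(c i + s) *: p i]; so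
[(c i + s) * cnorm (p i) <= s * cnorm (p i)]. *)
Lemma sum_projections_eq0 (I : finType) (c : I -> R) (p : I -> A) :
  (forall i, projection (p i)) -> (forall i, 0 <= c i) ->
  \sum_i (c i)%:C%C *: p i = 0 -> forall i, c i != 0 -> p i = 0.
Proof.
move=> pP c0 sp0 i ci0.
pose s := \sum_(k | k != i) c k.
pose y := \sum_(k | k != i) (c k)%:C%C *: (1 - p k).
have s0 : 0 <= s by apply: sumr_ge0.
have y_le : cnorm y <= s.
  apply: (big_ind2 (fun x t => cnorm x <= t)).
  - by rewrite cnorm0.
  - by move=> x a t b xa tb; rewrite (le_trans (cnormD _ _)) // lerD.
  - move=> k _; rewrite cnorm_scale_real // ler_piMr //.
    exact/cnorm_projection/projection_compl.
have sum_compl : \sum_k (c k)%:C%C *: (1 - p k) = (c i + s)%:C%C *: 1.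
  under eq_bigr do rewrite scalerBr.
  rewrite sumrB sp0 subr0 -scaler_suml -rmorph_sum /s.
  by rewrite (bigD1 i).
have [_ pp] := pP i.
have py : p i * y = (c i + s)%:C%C *: p i.
  (* the i-th term missing from y is killed by p i *)
  rewrite -[in RHS](mulr1 (p i)) scalerAr -sum_compl (bigD1 i) //= mulrDr.
  by rewrite -scalerAr mulrBr mulr1 pp subrr scaler0 add0r.
apply: cnorm_eq0; apply/eqP; rewrite eq_le cnorm_ge0 andbT.
have := cnormM (p i) y; rewrite py cnorm_scale_real ?addr_ge0 // => le1.
have cip : 0 < c i by rewrite lt_neqAle eq_sym ci0 c0.
have := cnorm_ge0 (p i); nra.
Qed.

End CStarProjections.

(** * The trace of an idempotent matrix *)

(** A full-rank factorization [M = C *m B] of an idempotent satisfies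
[B *m C = 1], so [\tr M] is the trace of an identity matrix of size
[\rank M]. *)
Lemma mxtrace_idempotent (F : fieldType) m (M : 'M[F]_m) :
  M *m M = M -> \tr M = (\rank M)%:R.
Proof.
move=> MM.
have [rinv rK] := row_freeP (row_base_free M).
have [linv lK] := row_fullP (col_base_full M).
have := mulmx_base M; move: (row_base M) (col_base M) rinv rK linv lK.
move=> B C rinv rK linv lK CB.
have BC1 : B *m C = 1%:M.
  have : linv *m (C *m B *m (C *m B)) *m rinv = linv *m (C *m B) *m rinv.
    by rewrite CB MM.
  by rewrite -!mulmxA rK mulmx1 !mulmxA lK !mul1mx.
by rewrite -{1}CB mxtrace_mulC BC1 mxtrace1.
Qed.

(** * Continuous functions and their integrals *)

Section ContinuousFunctions.
Context (R : realType) (X : ptopologicalType).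

(** Common to the real and the imaginary part. *)
Lemma cfun_part_continuous (part : R[i] -> R) (f : cfun R X) :
  (forall z w, part (z - w) = part z - part w) ->
  (forall z, (`|part z|%:C)%C <= `|z|) ->
  continuous (fun x => part (cfun_eval x f)).
Proof.
move=> partB part_le x; apply/cvgrPdist_lt => e e0; near=> y.
rewrite -ltcR -partB /=; apply: le_lt_trans (part_le _) _.
near: y; have e0' : 0 < (e%:C)%C by rewrite ltcR.
by have /cvgrPdist_lt := @cfun_continuous R X f x; exact.
Unshelve. all: by end_near. Qed.

Lemma Re_cfun_continuous (f : cfun R X) :
  continuous (fun x => complex.Re (cfun_eval x f)).
Proof.
by apply: cfun_part_continuous => [[a b] [c d] //|z]; exact: normc_ge_Re.
Qed.

Lemma Im_cfun_continuous (f : cfun R X) :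
  continuous (fun x => complex.Im (cfun_eval x f)).
Proof.
apply: cfun_part_continuous => [[a b] [c d] //|[a b]].
by rewrite normc_def lecR /= -sqrtr_sqr ler_wsqrtr // lerDr sqr_ge0.
Qed.

Lemma continuous_integrable (mu : probability (borelType X) R) (g : X -> R) :
  compact [set: X] -> continuous g ->
  mu.-integrable [set: borelType X] (EFin \o (g : borelType X -> R)).
Proof.
move=> cX cg; apply: measurable_bounded_integrable => //.
- exact: le_lt_trans (probability_le1 mu measurableT) (ltry _).
- apply: (measurability _ (measurable_realfun.RGenOpens.measurableE R)).
  move=> _ [_ [a [b ->] <-]]; rewrite setTI.
  by apply: sub_sigma_algebra; move/continuousP : cg; apply; exact: interval_open.
- have /compact_bounded [M [Mr Mb]] : compact (g @` [set: X]).
    by apply: continuous_compact => //; exact: continuous_subspaceT.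
  by exists M; split => // z Mz x _ /=; apply: Mb => //; exists x.
Qed.

(** The fibre of [g] through [x] is closed, and it is open because it is also
the preimage of the ball of radius 1. *)
Lemma nat_valued_constant (g : X -> R) :
  connected [set: X] -> continuous g ->
  (forall x, exists n : nat, g x = n%:R) -> forall x y, g x = g y.
Proof.
move=> cX cg gN x y.
have gE : [set z | g z = g x] = setT.
  apply: cX; first by exists x.
  - exists (g @^-1` (ball (g x) 1)).
      by move/continuousP: cg; apply; exact: ball_open.
    rewrite setTI; apply/seteqP; split => z /=.
      by move=> ->; exact: ballxx.
    have [m ->] := gN x; have [n ->] := gN z.
    rewrite /ball /= => h.
    have : `|m%:Z - n%:Z|%:~R < (1 : R) by rewrite intr_norm intrB.
    by rewrite ltrz1 ltr_norml => ?; congr (_%:R); lia.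
  - exists (g @^-1` [set g x]); last by rewrite setTI.
    by apply: closed_comp => [z _|]; [exact: cg|exact: closed_eq].
by have : setT y by []; rewrite -gE => ->.
Qed.

Lemma cfun_integralD (mu : probability (borelType X) R) (f g : cfun R X) :
  compact [set: X] ->
  cfun_integral mu (f + g) = cfun_integral mu f + cfun_integral mu g.
Proof.
move=> cX; rewrite /cfun_integral.
pose fR := continuous_integrable mu cX (@Re_cfun_continuous f).
pose gR := continuous_integrable mu cX (@Re_cfun_continuous g).
pose fI := continuous_integrable mu cX (@Im_cfun_continuous f).
pose gI := continuous_integrable mu cX (@Im_cfun_continuous g).
have ReD x : complex.Re (cfun_eval x (f + g)) =
    complex.Re (cfun_eval x f) + complex.Re (cfun_eval x g).
  by rewrite -[LHS]/(complex.Re (cfun_eval x f + cfun_eval x g)) raddfD.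
have ImD x : complex.Im (cfun_eval x (f + g)) =
    complex.Im (cfun_eval x f) + complex.Im (cfun_eval x g).
  by rewrite -[LHS]/(complex.Im (cfun_eval x f + cfun_eval x g)) raddfD.
under eq_Rintegral do rewrite ReD.
under [X in Complex _ X]eq_Rintegral do rewrite ImD.
by rewrite (RintegralD measurableT fR gR) (RintegralD measurableT fI gI).
Qed.

Lemma cfun_integral_nat (mu : probability (borelType X) R) (f : cfun R X) n :
  (forall x, cfun_eval x f = n%:R) -> cfun_integral mu f = n%:R.
Proof.
move=> fn; rewrite /cfun_integral.
have nE : (n%:R : R[i]) = Complex n%:R 0.
  by rewrite -(rmorph_nat (real_complex R)).
under eq_Rintegral do rewrite fn nE /=.
under [X in Complex _ X]eq_Rintegral do rewrite fn nE /=.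
rewrite !Rintegral_cst // mul0r.
by rewrite [X in fine X](@probability_setT _ _ _ mu) /= mulr1 nE.
Qed.

End ContinuousFunctions.

(** * Ranks and traces in M_K(C(X)) *)

Section ModelTrace.
Context (R : realType) (X : ptopologicalType) (K : nat).
Context (mu : probability (borelType X) R).
Implicit Types M : 'M[cfun R X]_K.

Lemma model_traceE M : compact [set: X] ->
  model_trace mu M = cfun_integral mu (\tr M) / K%:R.
Proof.
move=> cX; congr (_ / _); rewrite /mxtrace.
under eq_bigr do rewrite mxE.
apply/esym/(big_morph (cfun_integral mu)) => [f g|].
  exact: cfun_integralD.
exact: (@cfun_integral_nat _ _ _ _ 0).
Qed.

Lemma mxtrace_model_fiber M x : \tr (model_fiber M x) = cfun_eval x (\tr M).
Proof.
rewrite /mxtrace; under eq_bigr do rewrite mxE.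
exact/esym/(big_morph (cfun_eval x)).
Qed.

Lemma model_fiberM M M' x :
  model_fiber (M *m M') x = model_fiber M x *m model_fiber M' x.
Proof.
apply/matrixP => i j; rewrite !mxE.
rewrite (big_morph (cfun_eval x) (id1 := 0) (op1 := +%R)) //.
by apply: eq_bigr => k _; rewrite !mxE.
Qed.

(** The pointwise rank is the pointwise trace, which is continuous. *)
Lemma model_idempotent_rank M :
  compact [set: X] -> connected [set: X] -> M *m M = M ->
  exists2 n : nat, forall x, \rank (model_fiber M x) = n
                 & model_trace mu M = n%:R / K%:R.
Proof.
move=> cX kX MM.
have trE x : cfun_eval x (\tr M) = (\rank (model_fiber M x))%:R.
  by rewrite -mxtrace_model_fiber mxtrace_idempotent // -model_fiberM MM.
have Re_nat n : complex.Re (n%:R : R[i]) = n%:R by rewrite raddfMn.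
pose x0 : X := point.
have rankE x : \rank (model_fiber M x) = \rank (model_fiber M x0).
  apply/eqP; rewrite -(eqr_nat R) -!Re_nat -!trE; apply/eqP.
  apply: (nat_valued_constant kX (@Re_cfun_continuous _ _ (\tr M))) => y.
  by exists (\rank (model_fiber M y)); rewrite trE Re_nat.
exists (\rank (model_fiber M x0)) => //.
rewrite model_traceE //.
rewrite (@cfun_integral_nat _ _ _ _ (\rank (model_fiber M x0))) //.
by move=> x; rewrite trE rankE.
Qed.

End ModelTrace.

(** * Flatness of the Haar state on the standard generators *)

Section HaarOnGenerators.
Context (R : realType) (N : nat) (G : qperm_algebra R N).
Let u := qgen G.

(** The antipode is additive, so it maps 0 to 0. *)
Lemma qgen_sym i j : u i j != 0 -> u j i != 0.
Proof.
apply: contra_neq => uji0; rewrite -(antipode_gen G) -/u uji0.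
have [aD _ _ _ _] := antipode_morphism G.
by apply: (@addrI _ (antipode (0 : qalg G))); rewrite -aD !addr0.
Qed.

Lemma card_qorbit K i :
  quasi_transitive G K -> #|[set j | u i j != 0]%SET| = K.
Proof.
move=> GK; apply: GK; apply/imsetP; exists i; first by rewrite inE.
by apply/setP => j; rewrite !inE.
Qed.

Context (h : qalg G -> R[i]) (hP : is_haar h).

Let hD l x y : h (l *: x + y) = l * h x + h y.
Proof. by case: hP => -[]. Qed.

Lemma haar0 : h 0 = 0.
Proof.
have := hD 1 0 0; rewrite scaler0 mul1r addr0 => /eqP.
by rewrite -subr_eq0 opprD addNKr oppr_eq0 => /eqP.
Qed.

Lemma haar_sum (I : finType) (F : I -> qalg G) :
  h (\sum_k F k) = \sum_k h (F k).
Proof.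
apply: (big_morph h) => [x y|]; last exact: haar0.
by have := hD 1 x y; rewrite scale1r mul1r.
Qed.

Lemma haar_qgen_ge0 i j : 0 <= h (u i j).
Proof.
have [[_ _ h_ge0] _ _] := hP; have [uP _ _] := qgen_magic G.
by have := h_ge0 (u i j); have [-> ->] := uP i j.
Qed.

Lemma sum_haar_qgen i : \sum_j h (u i j) = 1.
Proof.
have [[_ h1 _] _ _] := hP; have [_ uR _] := qgen_magic G.
by rewrite -haar_sum uR.
Qed.

(** This is [(h (x) id) Delta = h(.) 1] evaluated at [u i j]. *)
Lemma haar_qgen_invariance i j :
  \sum_k h (u i k) *: u k j = h (u i j) *: 1.
Proof.
have [_ [L [[LD _] Lten Linv]] _] := hP.
have L0 : L 0 = 0.
  have := LD 1 0 0; rewrite !scale1r addr0 => /eqP.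
  by rewrite -subr_eq0 opprD addNKr oppr_eq0 => /eqP.
have LS x y : L (x + y) = L x + L y by have := LD 1 x y; rewrite !scale1r.
rewrite -Linv (comult_gen G) (big_morph L LS L0).
by apply: eq_bigr => k _; rewrite Lten.
Qed.

(** The maximum principle: the set [top] where [r] is maximal contains the
orbit of one of its elements [m] and lies in the orbit of [i].  Both orbits
have [K] elements, so [top] is the orbit of [i]. *)
Lemma haar_qgen K i j :
  quasi_transitive G K -> u i j != 0 -> h (u i j) = K%:R^-1.
Proof.
move=> GK uij.
pose r k := complex.Re (h (u i k)).
have hE k : h (u i k) = (r k)%:C%C.
  by rewrite RRe_real // ger0_real // haar_qgen_ge0.
have r_ge0 k : 0 <= r k by rewrite -lecR -hE haar_qgen_ge0.
have sum_r : \sum_k r k = 1.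
  apply: (@complexI R); rewrite rmorph_sum rmorph1 -(sum_haar_qgen i).
  by apply: eq_bigr => k _; rewrite hE.
pose m := [arg max_(k > j) r k]%O.
have r_le k : r k <= r m by rewrite /m; case: arg_maxP => // l _; exact.
have rm_gt0 : 0 < r m.
  rewrite lt_neqAle r_ge0 andbT; apply/eqP => rm0.
  have : \sum_k r k = 0.
    by apply: big1 => k _; apply/le_anti; rewrite r_ge0 rm0 r_le.
  by rewrite sum_r => /eqP; rewrite oner_eq0.
pose top := [set k | r k == r m]%SET.
have top_closed : ([set k | u m k != 0] \subset top)%SET.
  apply/fintype.subsetP => k; rewrite !inE => /qgen_sym.
  apply: contraR => rk; apply/eqP.
  have [uP _ uC] := qgen_magic G.
  apply: (@sum_projections_eq0 _ _ _ (fun k => r m - r k)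
            (fun k => u k m) _ _ _ k) => //.
  - by move=> l; rewrite subr_ge0.
  - transitivity (\sum_l (h (u i m) *: u l m - h (u i l) *: u l m)).
      by apply: eq_bigr => l _; rewrite -scalerBl !hE -rmorphB.
    by rewrite sumrB -scaler_sumr uC haar_qgen_invariance subrr.
  - by rewrite subr_eq0 eq_sym.
have top_orbit : (top \subset [set k | u i k != 0])%SET.
  apply/fintype.subsetP => k; rewrite !inE => /eqP rk.
  apply: contraTneq rm_gt0 => uik0.
  by rewrite -rk /r uik0 haar0 ltxx.
have topE : top = [set k | u i k != 0]%SET.
  apply/eqP; rewrite eqEcard top_orbit (card_qorbit i GK) -(card_qorbit m GK).
  exact: subset_leq_card.
have rmK : r m *+ K = 1.
  rewrite -sum_r (bigID (mem top)) /= [X in _ + X]big1 ?addr0 => [|k].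
    rewrite -(card_qorbit i GK) -topE -sumr_const.
    by apply: eq_bigr => k; rewrite inE => /eqP.
  by rewrite topE inE negbK => /eqP uik0; rewrite /r uik0 haar0.
have : j \in top by rewrite topE inE.
rewrite inE hE => /eqP ->; apply/esym/(mulr1_eq).
by rewrite mulr_natl -raddfMn /= rmK.
Qed.

End HaarOnGenerators.

(** * Stationary models are quasi-flat *)

Theorem theorem5p6 (R : realType) (N K : nat)
  (S : qperm_algebra R N) (hS : is_SNplus S)
  (G : qperm_algebra R N) (hGS : closed_subgroup G S)
  (hG : quasi_transitive G K)
  (haar : qalg G -> R[i]) (hhaar : is_haar haar)
  (X : ptopologicalType) (hXcompact : compact [set: X])
  (hXconnected : connected [set: X])
  (mu : probability (borelType X) R)
  (pi : qalg G -> 'M[cfun R X]_K) (hpi : matrix_model pi)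
  (hstat : stationary haar mu pi) :
  quasi_flat pi.
Proof.
move=> i j uij x.
have [[uP _ _] [_ piM _ _ _]] := (qgen_magic G, hpi).
have idem : pi (qgen G i j) *m pi (qgen G i j) = pi (qgen G i j).
  by have [_ {3}<-] := uP i j; rewrite piM.
have [n rankE trE] := model_idempotent_rank mu hXcompact hXconnected idem.
rewrite rankE; apply/eqP; rewrite -(eqr_nat R[i]).
have K0 : (K%:R : R[i]) != 0.
  rewrite pnatr_eq0 -(card_qorbit i hG) -lt0n card_gt0.
  by apply/set0Pn; exists j; rewrite inE.
apply/eqP/(mulIf (invr_neq0 K0)).
by rewrite -trE -hstat (haar_qgen hhaar hG uij) mul1r.
Qed.
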